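(* Fix $0<\vartheta<1$ and $\varepsilon_{\mathrm{CKN}}>0$. There is a constant $\tau_{\mathrm{CKN}}>0$, depending only on $\vartheta$ and $\varepsilon_{\mathrm{CKN}}$, such that the following holds. Let $D_k$ be a scale-$k$ package with normalized pressure-admissible fields $(u_k,p_k)$ on $Q_1$, baseline audit distance $\delta_k\ge0$, and suppose the CKN-compatible audit domination $$\delta_k^{\mathrm{CKN}}\le C_{\mathrm{CKN/aud}}\,\delta_k+\Delta_k^{\mathrm{gauge}}$$ holds. If $$C_{\mathrm{CKN/aud}}\,\delta_k+\Delta_k^{\mathrm{gauge}}\le\tau_{\mathrm{CKN}},$$ then $\Phi_k(\vartheta)<\varepsilon_{\mathrm{CKN}}$.
   Context: $Q_1=B_1\times(-1,0)\subset\mathbb R^3\times\mathbb R$, $Q_\vartheta=B_\vartheta\times(-\vartheta^2,0)$, $(f)_{B_\vartheta}=|B_\vartheta|^{-1}\int_{B_\vartheta}f$. Fields satisfy $u\in L^3(Q_1)^3$, $p\in L^{3/2}(Q_1)$. For a pair $(u,p)$ put $$\Phi(\vartheta)=\int_{Q_\vartheta}|u|^3+\int_{-\vartheta^2}^0\int_{B_\vartheta}|p-(p)_{B_\vartheta}(s)|^{3/2}\,dy\,ds;$$ $\Phi_k$ is this for $(u_k,p_k)$ and $\Phi_\zeta$ for $(u_\zeta,p_\zeta)$. The CKN-compatible clean class $\Gamma_{\Lambda,k}^{\mathrm{CKN}}$ is a selected class of packages $\zeta$ with associated normalized fields $(u_\zeta,p_\zeta)$ on $Q_1$ (pressure modulo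 time-dependent constants) satisfying $\Phi_\zeta(\vartheta)\le\varepsilon_{\mathrm{CKN}}/4$. The CKN-compatible distance is $$\delta_k^{\mathrm{CKN}}=\inf_{\zeta\in\Gamma_{\Lambda,k}^{\mathrm{CKN}}}\Bigl[\|u_k-u_\zeta\|_{L^3(Q_\vartheta)}+\inf_{a=a(s)}\|p_k-p_\zeta-a(s)\|_{L^{3/2}(Q_\vartheta)}\Bigr],$$ the inner infimum over functions of time. $\delta_k$ is the given audit baseline distance of $D_k$ to its gauge class, $\Delta_k^{\mathrm{gauge}}\ge0$ a given gauge comparison error, $C_{\mathrm{CKN/aud}}\ge0$ a given constant. *)

(* Defs.v *)
From HB Require Import structures.
From mathcomp Require Import all_boot all_order all_algebra.
From mathcomp Require Import all_classical all_reals all_analysis.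
Set Implicit Arguments.
Unset Strict Implicit.
Unset Printing Implicit Defensive.
Import Order.TTheory GRing.Theory Num.Theory.
Import numFieldNormedType.Exports.
Local Open Scope classical_set_scope.
Local Open Scope ring_scope.

(* The library has no Lebesgue measure on R^n, so R^3 is an iterated binary
   product, with the Borel sigma-algebra and the product Lebesgue measure. *)
Notation space R :=
  (measurableTypeR R * measurableTypeR R * measurableTypeR R)%type.
Notation spacetime R := (space R * measurableTypeR R)%type.

(* The library does not infer a sigma-finite structure on [m1 \x m2], which the
   Tonelli and Fubini theorems need. *)
Lemma sigma_finite_product d1 d2 (T1 : measurableType d1)
    (T2 : measurableType d2) (R : realType)
    (m1 : {sigma_finite_measure set T1 -> \bar R})
    (m2 : {sigma_finite_measure set T2 -> \bar R}) :
  sigma_finite [set: T1 * T2] (m1 \x m2)%E.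
Proof.
have /sigma_finiteP[F [TF ndF Foo]] := sigma_finiteT m1.
have /sigma_finiteP[G [TG ndG Goo]] := sigma_finiteT m2.
exists (fun n => F n `*` G n).
  rewrite -setXTT TF TG predeqE => -[x y]; split.
    move=> [/= [n _ Fnx] [k _ Gky]]; exists (maxn n k) => //; split.
    - by move: x Fnx; exact/subsetPset/ndF/leq_maxl.
    - by move: y Gky; exact/subsetPset/ndG/leq_maxr.
  by move=> [n _ []/= ? ?]; split; exists n.
move=> k; have [? ?] := Foo k; have [? ?] := Goo k.
split; first exact: measurableX.
by rewrite product_measure1E// lte_mul_pinfty// ge0_fin_numE.
Qed.

Definition leb1 (R : realType) : set (measurableTypeR R) -> \bar R :=
  @lebesgue_measure R.
Arguments leb1 : clear implicits.
HB.instance Definition _ (R : realType) := Measure.on (leb1 R).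
HB.instance Definition _ (R : realType) :=
  Measure_isSigmaFinite.Build _ _ _ (leb1 R)
    (sigma_finiteT (@lebesgue_measure R)).

Definition leb2 (R : realType) :
    set (measurableTypeR R * measurableTypeR R)%type -> \bar R :=
  (leb1 R \x leb1 R)%E.
Arguments leb2 : clear implicits.
HB.instance Definition _ (R : realType) := Measure.on (leb2 R).
HB.instance Definition _ (R : realType) :=
  Measure_isSigmaFinite.Build _ _ _ (leb2 R)
    (sigma_finite_product (leb1 R) (leb1 R)).

Definition leb3 (R : realType) : set (space R) -> \bar R :=
  (leb2 R \x leb1 R)%E.
Arguments leb3 : clear implicits.
HB.instance Definition _ (R : realType) := Measure.on (leb3 R).
HB.instance Definition _ (R : realType) :=
  Measure_isSigmaFinite.Build _ _ _ (leb3 R)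
    (sigma_finite_product (leb2 R) (leb1 R)).

Definition leb4 (R : realType) : set (spacetime R) -> \bar R :=
  (leb3 R \x leb1 R)%E.
Arguments leb4 : clear implicits.
HB.instance Definition _ (R : realType) := Measure.on (leb4 R).
HB.instance Definition _ (R : realType) :=
  Measure_isSigmaFinite.Build _ _ _ (leb4 R)
    (sigma_finite_product (leb3 R) (leb1 R)).

(* Euclidean norm; the norm [`|x|] of a product type is the sup norm. *)
Definition enorm3 (R : realType) (x : R * R * R) : R :=
  Num.sqrt (x.1.1 ^+ 2 + x.1.2 ^+ 2 + x.2 ^+ 2).

Definition ball3 (R : realType) (r : R) : set (space R) :=
  [set x | enorm3 x < r].

Definition time_itv (R : realType) (r : R) : set (measurableTypeR R) :=
  `]- r ^+ 2, 0[%classic.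

Definition cyl (R : realType) (r : R) : set (spacetime R) :=
  ball3 r `*` time_itv r.

(* Extending by zero off [A] gives the L^p(A) norm; [Lnorm] and [Lfun] live on
   whole types. *)
Definition Lnorm_on (R : realType) (p : R) (A : set (spacetime R))
    (f : spacetime R -> R) : \bar R :=
  'N[leb4 R]_p%:E [EFin \o (f \_ A)].

Definition Lp_on (R : realType) (p : R) (A : set (spacetime R))
    (f : spacetime R -> R) : Prop :=
  f \_ A \in Lfun (leb4 R) p%:E.

Record admissible_fields (R : realType) := AdmissibleFields {
  vel : spacetime R -> R * R * R;
  pres : spacetime R -> R;
  vel_L3 : [/\ Lp_on 3 (cyl 1) (fun z => (vel z).1.1),
               Lp_on 3 (cyl 1) (fun z => (vel z).1.2) &
               Lp_on 3 (cyl 1) (fun z => (vel z).2)];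
  pres_L32 : Lp_on (3 / 2) (cyl 1) pres
}.

Definition ball_mean (R : realType) (r : R) (p : spacetime R -> R) (s : R) : R :=
  (\int[leb3 R]_(y in ball3 r) p (y, s)) / fine (leb3 R (ball3 r)).

Definition Phi (R : realType) (r : R) (w : admissible_fields R) : \bar R :=
  (\int[leb4 R]_(z in cyl r) (enorm3 (vel w z) ^+ 3)%:E
   + \int[leb1 R]_(s in time_itv r) \int[leb3 R]_(y in ball3 r)
       (`|pres w (y, s) - ball_mean r (pres w) s| `^ (3 / 2))%:E)%E.

(* The inner infimum ranges over measurable functions of time: the integral of
   a nonmeasurable function has no meaning. *)
Definition pressure_dist (R : realType) (r : R) (p q : spacetime R -> R) :
    \bar R :=
  ereal_inf [set Lnorm_on (3 / 2) (cyl r) (fun z => p z - q z - a z.2)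
            | a in [set a : measurableTypeR R -> R
                   | measurable_fun (time_itv r) a]].

Definition fields_dist (R : realType) (r : R) (w v : admissible_fields R) :
    \bar R :=
  (Lnorm_on 3 (cyl r) (fun z => enorm3 (vel w z - vel v z)%R)
   + pressure_dist r (pres w) (pres v))%E.

(* Extended-real valued, so that the distance to an empty class is +oo. *)
Definition ckn_dist (R : realType) (Pkg : Type)
    (fields : Pkg -> admissible_fields R) (r : R) (D : Pkg) (G : set Pkg) :
    \bar R :=
  ereal_inf [set fields_dist r (fields D) (fields zeta) | zeta in G].

Definition ckn_clean_class (R : realType) (Pkg : Type)
    (fields : Pkg -> admissible_fields R) (r eps : R) (G : set Pkg) : Prop :=
  forall zeta, G zeta -> (Phi r (fields zeta) <= (eps / 4)%:E)%E.

(* Main.v *)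
(* By definition of the infimum some clean zeta lies at distance less than d
   from D_k. The bound (x + y)^p <= 2 x^p + 125 y^p for 0 <= p <= 3 replaces the
   sharp Minkowski inequality: its factor 2 turns the clean bound eps/4 into
   eps/2, and every other term is at most a constant times d, hence below eps/4
   for small d. Subtracting ball means removes the gauge function a(s), and it
   costs only a constant in the L^p norm on almost every time slice. *)
Require Import Defs.
From mathcomp Require Import all_boot all_order all_algebra.
From mathcomp Require Import all_classical all_reals all_analysis.
From mathcomp Require Import measurable_realfun ring lra.
Set Implicit Arguments.
Unset Strict Implicit.
Unset Printing Implicit Defensive.
Import Order.TTheory GRing.Theory Num.Theory.
Import numFieldNormedType.Exports.
Local Open Scope classical_set_scope.
Local Open Scope ring_scope.

(** * Elementary inequalities for real powers *)

(** If [y <= x / 4], then [x + y <= (5/4) x] and (5/4)^3 = 125/64 <= 2; otherwise [x + y <= 5 y] and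
    5^3 = 125. Since the dilation factor is at least 1 and [p <= 3], its [p]-th power is at most its
    cube. *)
Lemma powRD_le (R : realType) (p x y : R) : 0 <= p -> p <= 3 -> 0 <= x ->
  0 <= y -> (x + y) `^ p <= 2 * x `^ p + 125 * y `^ p.
Proof.
move=> p0 p3 x0 y0.
have powle c K : 1 <= c -> c ^+ 3 <= K -> c `^ p <= K.
  move=> c1; apply: le_trans; rewrite -powR_mulrn; last by rewrite (le_trans _ c1).
  by apply: ler_powR.
have dil c K z : 1 <= c -> c ^+ 3 <= K -> 0 <= z -> x + y <= c * z ->
    (x + y) `^ p <= K * z `^ p.
  move=> c1 cK z0 xyz.
  have c0 : 0 <= c by rewrite (le_trans _ c1).
  apply: (@le_trans _ _ ((c * z) `^ p)).
    by apply: ge0_ler_powR => //; rewrite nnegrE ?mulr_ge0 ?addr_ge0.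
  by rewrite powRM// ler_wpM2r ?powR_ge0// powle.
have [yx|xy] := leP y (x / 4).
  have /le_trans -> // : (x + y) `^ p <= 2 * x `^ p.
    by apply: (dil (5 / 4)) => //; lra.
  by rewrite lerDl mulr_ge0 ?powR_ge0.
have /le_trans -> // : (x + y) `^ p <= 125 * y `^ p by apply: (dil 5) => //; lra.
by rewrite lerDr mulr_ge0 ?powR_ge0.
Qed.

(** A crude Young inequality: the left-hand side is at most the [p]-th power of the larger of [c]
    and [t]. It is linear in [t], so integrating it brings in the mean. *)
Lemma mulr_powR_le (R : realType) (p c t : R) : 1 <= p -> 0 <= c -> 0 <= t ->
  c `^ (p - 1) * t <= c `^ p + t `^ p.
Proof.
move=> p1 c0 t0.
have split_pow x : 0 <= x -> x `^ p = x `^ (p - 1) * x.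
  by move=> x0; rewrite mulrC mulr_powRB1// (lt_le_trans _ p1).
have [tc|/ltW ct] := leP t c.
  by rewrite ler_wpDr ?powR_ge0// (split_pow c)// ler_wpM2l ?powR_ge0.
rewrite ler_wpDl ?powR_ge0// (split_pow t)// ler_wpM2r//.
by apply: ge0_ler_powR; rewrite ?subr_ge0.
Qed.

(** * Means and oscillations on a set of finite measure *)

(** [ball_mean] unfolds to the instance with [leb3 R] and [ball3 r]. If [m B] is 0 or infinite, the
    denominator is 0 and so is the mean. *)
Definition mean_on d (T : measurableType d) (R : realType)
    (m : {measure set T -> \bar R}) (B : set T) (f : T -> R) : R :=
  (\int[m]_(x in B) f x) / fine (m B).

(** Jensen's inequality with factor 8 instead of 1; the pointwise bound [mulr_powR_le] takes the
    place of convexity. *)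
Lemma mean_powR_le d (T : measurableType d) (R : realType)
    (m : {measure set T -> \bar R}) (B : set T) (p : R) (h : T -> R) :
  measurable B -> (m B < +oo)%E -> 1 <= p -> p <= 3 ->
  m.-integrable B (EFin \o h) ->
  (((`|mean_on m B h|) `^ p * fine (m B))%:E
     <= 8%:E * \int[m]_(x in B) (`|h x| `^ p)%:E)%E.
Proof.
move=> mB Boo p1 p3 ih.
have p0 : 0 < p by rewrite (lt_le_trans _ p1).
have mh : measurable_fun B h by apply/measurable_EFinP; exact: measurable_int ih.
have mhp : measurable_fun B (fun x => (`|h x| `^ p)%:E).
  apply/measurable_EFinP; apply: (measurableT_comp (measurable_powR p)).
  exact: measurableT_comp.
have V0 : 0 <= fine (m B) by rewrite fine_ge0.
have J0 : (0 <= \int[m]_(x in B) (`|h x| `^ p)%:E)%E.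
  by apply: integral_ge0 => x _; rewrite lee_fin powR_ge0.
have [V00|Vn0] := eqVneq (fine (m B)) 0.
  by rewrite V00 mulr0 mule_ge0.
have Vgt0 : 0 < fine (m B) by rewrite lt_neqAle eq_sym Vn0.
have ih' : m.-integrable B (fun x => `|(h x)%:E|%E) by exact: integrable_abse.
set A := (\int[m]_(x in B) `|h x|) / fine (m B).
have A0 : 0 <= A by rewrite divr_ge0// Rintegral_ge0.
have MA : `|mean_on m B h| <= A.
  rewrite /mean_on normrM normfV (ger0_norm V0) ler_pM2r ?invr_gt0//.
  exact: le_normr_Rintegral.
(* Integrate [c^(p-1) t <= c^p + t^p] with [c = A/2] and [t = |h|]: half of the
   left-hand side absorbs the constant term. *)
have key : (((A / 2) `^ p * fine (m B))%:E <= \int[m]_(x in B) (`|h x| `^ p)%:E)%E.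
  set c := A / 2; have c0 : 0 <= c by rewrite divr_ge0.
  have : (\int[m]_(x in B) ((c `^ (p - 1))%:E * `|h x|%:E)
      <= \int[m]_(x in B) ((c `^ p)%:E + (`|h x| `^ p)%:E))%E.
    apply: ge0_le_integral => //.
    - by move=> x _; rewrite -EFinM lee_fin mulr_ge0// powR_ge0.
    - by apply/measurable_EFinP/measurable_funM => //; apply: measurableT_comp.
    - by apply: emeasurable_funD.
    - by move=> x _; rewrite -EFinM -EFinD lee_fin mulr_powR_le.
  rewrite ge0_integralZl_EFin ?powR_ge0//; last first.
    by apply/measurable_EFinP; apply: measurableT_comp.
  rewrite ge0_integralD//; last by move=> x _; rewrite lee_fin powR_ge0.
  have -> : (\int[m]_(x in B) `|h x|%:E = (2 * c * fine (m B))%:E)%E.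
    have -> : 2 * c * fine (m B) = \int[m]_(x in B) `|h x|.
      by rewrite /c mulrCA divff// mulr1 /A divfK.
    by rewrite /Rintegral fineK//; exact: integrable_fin_num.
  have -> : (\int[m]_(x in B) (c `^ p)%:E = (c `^ p * fine (m B))%:E)%E.
    by rewrite (integral_cst _ mB) EFinM fineK// ge0_fin_numE.
  have -> : ((c `^ (p - 1))%:E * (2 * c * fine (m B))%:E
     = (c `^ p * fine (m B))%:E + (c `^ p * fine (m B))%:E)%E.
    rewrite -EFinM -EFinD; congr EFin.
    by rewrite -(mulr_powRB1 c0 p0); ring.
  by rewrite leeD2lE.
apply: (@le_trans _ _ ((8 * ((A / 2) `^ p * fine (m B)))%:E)).
  rewrite lee_fin mulrA ler_wpM2r//.
  apply: (@le_trans _ _ (A `^ p)).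
    by apply: ge0_ler_powR => //; apply: ltW.
  (* Undoing the halving of [A] costs 2^p <= 2^3 = 8. *)
  have {1}-> : A = 2 * (A / 2) by rewrite mulrCA divff ?mulr1.
  have A20 : 0 <= A / 2 by rewrite mulr_ge0.
  rewrite powRM// ler_wpM2r ?powR_ge0// (@le_trans _ _ (2 `^ 3))//.
    by rewrite ler_powR// ler1n.
  by rewrite powR_mulrn// -natrX ler_nat.
by rewrite EFinM lee_pmul2l// lte_fin.
Qed.

Lemma measurable_normr_powR d (T : measurableType d) (R : realType)
    (D : set T) (p : R) (f : T -> R) :
  measurable_fun D f -> measurable_fun D (fun x => (`|f x| `^ p)%:E).
Proof.
move=> mf; apply/measurable_EFinP; apply: (measurableT_comp (measurable_powR p)).
exact: measurableT_comp.
Qed.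

(** The domination is asked only almost everywhere because it will be applied in time, where it is
    known only on slices with integrable pressures. *)
Lemma le_integral_lincomb d (T : measurableType d) (R : realType)
    (m : {measure set T -> \bar R}) (D : set T) (b c : R) (f g h : T -> \bar R) :
  measurable D -> 0 <= b -> 0 <= c ->
  measurable_fun D f -> measurable_fun D g -> measurable_fun D h ->
  (forall x, 0 <= f x)%E -> (forall x, 0 <= g x)%E -> (forall x, 0 <= h x)%E ->
  {ae m, forall x, D x -> (f x <= b%:E * g x + c%:E * h x)%E} ->
  (\int[m]_(x in D) f x
     <= b%:E * \int[m]_(x in D) g x + c%:E * \int[m]_(x in D) h x)%E.
Proof.
move=> mD b0 c0 mf mg mh f0 g0 h0 fgh.
rewrite -!ge0_integralZl_EFin// -ge0_integralD//.
- apply: ae_ge0_le_integral => //.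
    by move=> x _; rewrite adde_ge0 ?mule_ge0.
  by apply: emeasurable_funD; exact: measurable_funeM.
- by move=> x _; rewrite mule_ge0.
- exact: measurable_funeM.
- by move=> x _; rewrite mule_ge0.
- exact: measurable_funeM.
Qed.

Lemma integral_powRD_le d (T : measurableType d) (R : realType)
    (m : {measure set T -> \bar R}) (B : set T) (p : R) (f g h : T -> R) :
  0 <= p -> p <= 3 -> measurable B ->
  measurable_fun B f -> measurable_fun B g -> measurable_fun B h ->
  (forall x, B x -> `|f x| <= `|g x| + `|h x|) ->
  (\int[m]_(x in B) (`|f x| `^ p)%:E
     <= 2%:E * \int[m]_(x in B) (`|g x| `^ p)%:E
        + 125%:E * \int[m]_(x in B) (`|h x| `^ p)%:E)%E.
Proof.
move=> p0 p3 mB mf mg mh fgh.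
have pge0 (u : T -> R) x : (0 <= (`|u x| `^ p)%:E)%E by rewrite lee_fin powR_ge0.
apply: le_integral_lincomb => //; [exact: measurable_normr_powR..|].
apply: nearW => x Bx; rewrite -!EFinM -EFinD lee_fin.
apply: (@le_trans _ _ ((`|g x| + `|h x|) `^ p)); last exact: powRD_le.
by apply: ge0_ler_powR; rewrite ?nnegrE ?addr_ge0//; exact: fgh.
Qed.

(** Split [h] minus its mean by [integral_powRD_le]; the constant term is then controlled by
    [mean_powR_le]. Hence 1002 = 2 + 125 * 8. *)
Lemma oscillation_powR_le d (T : measurableType d) (R : realType)
    (m : {measure set T -> \bar R}) (B : set T) (p : R) (h : T -> R) :
  measurable B -> (m B < +oo)%E -> 1 <= p -> p <= 3 ->
  m.-integrable B (EFin \o h) ->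
  (\int[m]_(x in B) (`|h x - mean_on m B h| `^ p)%:E
     <= 1002%:E * \int[m]_(x in B) (`|h x| `^ p)%:E)%E.
Proof.
move=> mB Boo p1 p3 ih.
have p0 : 0 <= p by rewrite (le_trans _ p1).
have mh : measurable_fun B h by apply/measurable_EFinP; exact: measurable_int ih.
have J0 : (0 <= \int[m]_(x in B) (`|h x| `^ p)%:E)%E.
  by apply: integral_ge0 => x _; rewrite lee_fin powR_ge0.
apply: (le_trans (@integral_powRD_le _ _ _ m B p _ h (cst (mean_on m B h))
  p0 p3 mB _ mh _ _)) => //.
- exact: measurable_funB.
- by move=> x _; exact: ler_normB.
rewrite [X in (_ + _ * X)%E](_ : _ =
  ((`|mean_on m B h| `^ p) * fine (m B))%:E); last first.
  rewrite (eq_integral (cst (`|mean_on m B h| `^ p)%:E))//.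
  by rewrite (integral_cst _ mB) EFinM fineK// ge0_fin_numE.
have -> : (1002%:E = 2%:E + 125%:E * 8%:E :> \bar R)%E.
  by rewrite -EFinM -EFinD; congr EFin; ring.
rewrite ge0_muleDl ?mule_ge0 ?lee_fin//.
by rewrite leeD2l// -muleA lee_pmul2l ?lte_fin// mean_powR_le.
Qed.

Lemma integrable_cst_on d (T : measurableType d) (R : realType)
    (m : {measure set T -> \bar R}) (B : set T) (c : R) :
  measurable B -> (m B < +oo)%E -> m.-integrable B (EFin \o cst c).
Proof.
move=> mB Boo; apply/integrableP; split; first exact/measurable_EFinP.
rewrite (eq_integral (cst `|c|%:E)) ?(integral_cst _ mB)//.
by rewrite lte_mul_pinfty.
Qed.

Lemma integrable_constB d (T : measurableType d) (R : realType)
    (m : {measure set T -> \bar R}) (B : set T) (f g : T -> R) (c : R) :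
  measurable B -> (m B < +oo)%E ->
  m.-integrable B (EFin \o f) -> m.-integrable B (EFin \o g) ->
  m.-integrable B (EFin \o (fun x => f x - g x - c)).
Proof.
move=> mB Boo if_ ig.
exact: (integrableB mB (integrableB mB if_ ig) (integrable_cst_on c mB Boo)).
Qed.

(** Put [h = f - g - c]. The constant [c] disappears once means are subtracted, so the oscillation
    of [f] is that of [g] plus that of [h]. The large constant falls on [h] alone and [g] keeps the
    factor 2. *)
Lemma oscillation_powR_perturb d (T : measurableType d) (R : realType)
    (m : {measure set T -> \bar R}) (B : set T) (p c : R) (f g : T -> R) :
  measurable B -> (0 < m B < +oo)%E -> 1 <= p -> p <= 3 ->
  m.-integrable B (EFin \o f) -> m.-integrable B (EFin \o g) ->
  (\int[m]_(x in B) (`|f x - mean_on m B f| `^ p)%:E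
     <= 2%:E * \int[m]_(x in B) (`|g x - mean_on m B g| `^ p)%:E
        + (125 * 1002)%:E * \int[m]_(x in B) (`|f x - g x - c| `^ p)%:E)%E.
Proof.
move=> mB /andP[B0 Boo] p1 p3 if_ ig.
have p0 : 0 <= p by rewrite (le_trans _ p1).
pose h x := f x - g x - c.
have ih : m.-integrable B (EFin \o h) by exact: integrable_constB.
have mf : measurable_fun B f by apply/measurable_EFinP; exact: measurable_int if_.
have mg : measurable_fun B g by apply/measurable_EFinP; exact: measurable_int ig.
have mh : measurable_fun B h by apply/measurable_EFinP; exact: measurable_int ih.
(* The mean of the constant [c] is [c] because [m B] is finite and nonzero. *)
have meanE : mean_on m B f = mean_on m B g + mean_on m B h + c.
  have V0 : fine (m B) != 0 by rewrite gt_eqF// fine_gt0// B0.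
  have iB := integrableB mB if_ ig.
  have ic := integrable_cst_on c mB Boo.
  have hE : \int[m]_(x in B) h x =
      \int[m]_(x in B) f x - \int[m]_(x in B) g x - c * fine (m B).
    rewrite /h (RintegralB mB iB ic) (RintegralB mB if_ ig).
    by rewrite (Rintegral_cst _ mB).
  rewrite /mean_on hE -[X in _ = _ + X](mulfK V0) -!mulrDl.
  by congr (_ / _); ring.
apply: (le_trans (@integral_powRD_le _ _ _ m B p _
  (fun x => g x - mean_on m B g) (fun x => h x - mean_on m B h)
  p0 p3 mB _ _ _ _)) => //.
- exact: measurable_funB.
- exact: measurable_funB.
- exact: measurable_funB.
- move=> x _; apply: le_trans (ler_normD _ _).
  rewrite (_ : f x - _ = g x - mean_on m B g + (h x - mean_on m B h))//.
  by rewrite meanE /h; ring.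
rewrite leeD2l//.
by rewrite EFinM -muleA lee_pmul2l ?lte_fin// oscillation_powR_le.
Qed.

(** * Slicing integrals over a product set *)

Lemma patch_setX_section (T1 T2 : Type) (V : pointedType) (B : set T1) (I : set T2)
    (f : T1 * T2 -> V) (s : T2) : I s ->
  (fun y => (f \_ (B `*` I)) (y, s)) = (fun y => f (y, s)) \_ B.
Proof.
move=> Is; apply/funext => y; rewrite !patchE.
by rewrite in_setX (mem_set Is) andbT.
Qed.

(** Tonelli's theorem is applied to the extension of [f] by zero off the product set; at times in
    [I] its sections are the extensions by zero of those of [f]. *)
Lemma measurable_section_integral d1 d2 (T1 : measurableType d1)
    (T2 : measurableType d2) (R : realType)
    (m1 : {sigma_finite_measure set T1 -> \bar R}) (B : set T1) (I : set T2)
    (f : T1 * T2 -> \bar R) :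
  measurable B -> measurable I -> measurable_fun (B `*` I) f ->
  (forall z, (B `*` I) z -> 0 <= f z)%E ->
  measurable_fun I (fun s => \int[m1]_(y in B) f (y, s))%E.
Proof.
move=> mB mI mf f0.
have mBI : measurable (B `*` I) by exact: measurableX.
apply: (@eq_measurable_fun _ _ _ _ _ (fubini_G m1 (f \_ (B `*` I)))).
  move=> s; rewrite inE => Is.
  by rewrite /fubini_G /= [RHS]integral_mkcond -(patch_setX_section _ _ Is).
apply: (measurable_funS measurableT) => //.
apply: measurable_fun_fubini_tonelli_G; first exact/(measurable_restrictT _ mBI).
exact: erestrict_ge0.
Qed.

Lemma tonelli_setX d1 d2 (T1 : measurableType d1)
    (T2 : measurableType d2) (R : realType)
    (m1 : {sigma_finite_measure set T1 -> \bar R})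
    (m2 : {sigma_finite_measure set T2 -> \bar R}) (B : set T1) (I : set T2)
    (f : T1 * T2 -> \bar R) :
  measurable B -> measurable I -> measurable_fun (B `*` I) f ->
  (forall z, (B `*` I) z -> 0 <= f z)%E ->
  (\int[m1 \x m2]_(z in B `*` I) f z
     = \int[m2]_(s in I) \int[m1]_(y in B) f (y, s))%E.
Proof.
move=> mB mI mf f0.
have mBI : measurable (B `*` I) by exact: measurableX.
rewrite integral_mkcond fubini_tonelli2; last 2 first.
- exact/(measurable_restrictT _ mBI).
- exact: erestrict_ge0.
rewrite [RHS]integral_mkcond; apply: eq_integral => s _.
rewrite /fubini_G patchE; case: ifPn => [|sI].
  by rewrite inE => Is; rewrite [RHS]integral_mkcond -(patch_setX_section _ _ Is).
(* For [s] outside [I] the whole section of the extension vanishes, matching the extension by zero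
   of the outer integrand. *)
rewrite (eq_integral (cst 0%E)) ?integral0// => y _.
by rewrite patchE memNset// => -[_ /= Is]; rewrite mem_set in sI.
Qed.

(** The integrals of the positive and negative parts are measurable in [s] by Tonelli, hence so is
    their difference; [fine] is a measurable map to the reals. *)
Lemma measurable_section_mean d1 d2 (T1 : measurableType d1)
    (T2 : measurableType d2) (R : realType)
    (m1 : {sigma_finite_measure set T1 -> \bar R}) (B : set T1) (I : set T2)
    (f : T1 * T2 -> R) :
  measurable B -> measurable I -> measurable_fun (B `*` I) f ->
  measurable_fun I (fun s => mean_on m1 B (fun y => f (y, s))).
Proof.
move=> mB mI mf.
have mEf : measurable_fun (B `*` I) (EFin \o f) by exact/measurable_EFinP.
apply: measurable_funM => //.
apply: (measurableT_comp (@fine_measurable R _ measurableT)).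
under eq_fun do rewrite integralE.
apply: emeasurable_funB.
- apply: (eq_measurable_fun (fun s => \int[m1]_(y in B) (EFin \o f)^\+ (y, s)))%E.
    by move=> s _; apply: eq_integral => y _; rewrite !funeposE.
  by apply: measurable_section_integral => //; exact: measurable_funepos.
- apply: (eq_measurable_fun (fun s => \int[m1]_(y in B) (EFin \o f)^\- (y, s)))%E.
    by move=> s _; apply: eq_integral => y _; rewrite !funenegE.
  by apply: measurable_section_integral => //; exact: measurable_funeneg.
Qed.

Lemma measurable_snd_setX d1 d2 (T1 : measurableType d1)
    (T2 : measurableType d2) (R : realType) (B : set T1) (I : set T2)
    (a : T2 -> R) :
  measurable B -> measurable I -> measurable_fun I a ->
  measurable_fun (B `*` I) (fun z => a z.2).
Proof.
move=> mB mI ma; apply: (measurable_comp mI _ ma).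
  by move=> _ [[y s] [_ Is] <-].
exact: (measurable_funS measurableT).
Qed.

Lemma ae_integrable_section d1 d2 (T1 : measurableType d1)
    (T2 : measurableType d2) (R : realType)
    (m1 : {sigma_finite_measure set T1 -> \bar R})
    (m2 : {sigma_finite_measure set T2 -> \bar R}) (B : set T1) (I : set T2)
    (f : T1 * T2 -> R) :
  measurable B -> measurable I ->
  (m1 \x m2)%E.-integrable (B `*` I) (EFin \o f) ->
  {ae m2, forall s, I s -> m1.-integrable B (EFin \o (fun y => f (y, s)))}.
Proof.
move=> mB mI if_.
have mBI : measurable (B `*` I) by exact: measurableX.
have := ae_integrable2 ((integrable_mkcond _ mBI).1 if_).
apply: filterS => s + Is.
by rewrite (patch_setX_section _ _ Is) => /(integrable_mkcond _ mB).
Qed.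

(** Apply [oscillation_powR_perturb] on almost every slice with the constant [c = a s], then
    integrate over [I]. This is how an arbitrary measurable gauge function of time is removed. *)
Lemma integral_oscillation_perturb d1 d2 (T1 : measurableType d1)
    (T2 : measurableType d2) (R : realType)
    (m1 : {sigma_finite_measure set T1 -> \bar R})
    (m2 : {sigma_finite_measure set T2 -> \bar R}) (B : set T1) (I : set T2)
    (p : R) (f g : T1 * T2 -> R) (a : T2 -> R) :
  measurable B -> measurable I -> (0 < m1 B < +oo)%E -> 1 <= p -> p <= 3 ->
  (m1 \x m2)%E.-integrable (B `*` I) (EFin \o f) ->
  (m1 \x m2)%E.-integrable (B `*` I) (EFin \o g) ->
  measurable_fun I a ->
  (\int[m2]_(s in I) \int[m1]_(y in B)
       (`|f (y, s) - mean_on m1 B (fun x => f (x, s))| `^ p)%:E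
     <= 2%:E * \int[m2]_(s in I) \int[m1]_(y in B)
       (`|g (y, s) - mean_on m1 B (fun x => g (x, s))| `^ p)%:E
     + (125 * 1002)%:E *
       \int[m1 \x m2]_(z in B `*` I) (`|f z - g z - a z.2| `^ p)%:E)%E.
Proof.
move=> mB mI B0oo p1 p3 if_ ig ma.
have mf : measurable_fun (B `*` I) f.
  by apply/measurable_EFinP; exact: measurable_int if_.
have mg : measurable_fun (B `*` I) g.
  by apply/measurable_EFinP; exact: measurable_int ig.
(* Used three times, with [b] the slice mean of [f], the slice mean of [g], and the gauge [a]. *)
have mosc (u : T1 * T2 -> R) (b : T2 -> R) :
    measurable_fun (B `*` I) u -> measurable_fun I b ->
    measurable_fun I (fun s => \int[m1]_(y in B) (`|u (y, s) - b s| `^ p)%:E)%E.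
  move=> mu mb.
  apply: (@measurable_section_integral _ _ _ _ _ m1 _ _
    (fun z => (`|u z - b z.2| `^ p)%:E)) => //.
  apply: measurable_normr_powR; apply: measurable_funB => //.
  exact: measurable_snd_setX.
have mfg : measurable_fun (B `*` I) (fun z => f z - g z) by exact: measurable_funB.
have osc0 (u : T1 * T2 -> R) (b : T2 -> R) s :
    (0 <= \int[m1]_(y in B) (`|u (y, s) - b s| `^ p)%:E)%E.
  by apply: integral_ge0 => y _; rewrite lee_fin powR_ge0.
have mF := mosc _ _ mf (measurable_section_mean m1 mB mI mf).
have mG := mosc _ _ mg (measurable_section_mean m1 mB mI mg).
have mH := mosc _ _ mfg ma.
(* The error term becomes an iterated integral, so that all three terms are integrals over [I] and
   can be compared slice by slice. *)
rewrite (tonelli_setX _ _ mB mI)//; last first.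
  apply: measurable_normr_powR; apply: measurable_funB => //.
  exact: measurable_snd_setX.
apply: le_integral_lincomb mF mG mH _ _ _ _.
- exact: mI.
- exact: ler0n.
- exact: mulr_ge0 (ler0n _ _) (ler0n _ _).
- by move=> s; exact: (osc0 f (fun s => mean_on m1 B (fun x => f (x, s)))).
- by move=> s; exact: (osc0 g (fun s => mean_on m1 B (fun x => g (x, s)))).
- by move=> s; exact: (osc0 (fun z => f z - g z) a).
have aef := ae_integrable_section mB mI if_.
have aeg := ae_integrable_section mB mI ig.
apply: filterS2 aef aeg => s ifs igs Is.
exact: oscillation_powR_perturb (ifs Is) (igs Is).
Qed.

(** * Euclidean norm, balls and cylinders *)

Lemma enorm3_ge0 (R : realType) (u : R * R * R) : 0 <= enorm3 u.
Proof. exact: sqrtr_ge0. Qed.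

Lemma enorm3_le_add (R : realType) (u v : R * R * R) :
  enorm3 u <= enorm3 v + enorm3 (u - v).
Proof.
have sq (w : R * R * R) : enorm3 w ^+ 2 = w.1.1 ^+ 2 + w.1.2 ^+ 2 + w.2 ^+ 2.
  by rewrite /enorm3 sqr_sqrtr// !addr_ge0 ?sqr_ge0.
have [v0 w0] := (enorm3_ge0 v, enorm3_ge0 (u - v)).
rewrite -(@ler_pXn2r _ 2) ?nnegrE ?addr_ge0 ?enorm3_ge0//.
rewrite sqrrD !sq /=.
set A := enorm3 v in v0 *; set B := enorm3 (u - v) in w0 *.
move: (sq v) (sq (u - v)); rewrite -/A -/B /= => A2 B2.
case: u @B w0 B2 => [[a1 a2] a3] B w0 /= B2.
case: v @A @B v0 A2 w0 B2 => [[b1 b2] b3] A B v0 /= A2 w0 B2.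
set c1 := a1 - b1 in B2 *; set c2 := a2 - b2 in B2 *; set c3 := a3 - b3 in B2 *.
have [-> -> ->] : [/\ a1 = b1 + c1, a2 = b2 + c2 & a3 = b3 + c3].
  by rewrite /c1 /c2 /c3; split; ring.
(* With [u = v + c], the squared triangle inequality reduces to the Cauchy-Schwarz inequality. *)
suff : b1 * c1 + b2 * c2 + b3 * c3 <= A * B by clearbody A B; nra.
apply: (le_trans (ler_norm _)).
rewrite -(@ler_pXn2r _ 2) ?nnegrE ?mulr_ge0//.
rewrite real_normK ?num_real// exprMn A2 B2.
rewrite -subr_ge0.
(* Lagrange's identity: the defect in Cauchy-Schwarz is the squared length of the cross product. *)
rewrite (_ : _ - _ = (b1 * c2 - b2 * c1) ^+ 2 + (b1 * c3 - b3 * c1) ^+ 2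
   + (b2 * c3 - b3 * c2) ^+ 2); last by ring.
by rewrite !addr_ge0 ?sqr_ge0.
Qed.

Lemma measurable_enorm3 d (T : measurableType d) (R : realType) (D : set T)
    (u : T -> R * R * R) :
  measurable_fun D (fun z => (u z).1.1) -> measurable_fun D (fun z => (u z).1.2) ->
  measurable_fun D (fun z => (u z).2) -> measurable_fun D (fun z => enorm3 (u z)).
Proof.
move=> m1 m2 m3; rewrite /enorm3.
apply: (measurableT_comp (continuous_measurable_fun (@sqrt_continuous R))).
by apply: measurable_funD; [apply: measurable_funD|]; exact: measurable_funX.
Qed.

Lemma measurable_ball3 (R : realType) (r : R) : measurable (ball3 r).
Proof.
have m : @measurable_fun _ _
    (measurableTypeR R * measurableTypeR R * measurableTypeR R)%type
    (measurableTypeR R) setT (@enorm3 R).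
  apply: (measurable_enorm3 (u := id)) => //.
  - exact: (measurableT_comp measurable_fst measurable_fst).
  - exact: (measurableT_comp measurable_snd measurable_fst).
  - exact: measurable_snd.
have := m measurableT _ (measurable_itv `]-oo, r[).
rewrite setTI; congr measurable; apply/seteqP; split => x;
  by rewrite /ball3 /= in_itv.
Qed.

Lemma measurable_time_itv (R : realType) (r : R) : measurable (time_itv r).
Proof. exact: measurable_itv. Qed.

Lemma measurable_cyl (R : realType) (r : R) : measurable (cyl r).
Proof. exact: measurableX (measurable_ball3 r) (measurable_time_itv r). Qed.

Lemma leb3_box (R : realType) (a b : R) : a <= b ->
  let J : set (measurableTypeR R) := `]a, b[%classic in
  leb3 R (J `*` J `*` J) = ((b - a) ^+ 3)%:E.
Proof.
move=> ab J.
have mJ : measurable J by exact: measurable_itv.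
have EJ : leb1 R J = (b - a)%:E.
  rewrite /leb1 /J lebesgue_measure_itv /= lte_fin.
  by case: ltgtP ab => // -> _; rewrite subrr.
have mJJ : measurable (J `*` J) by exact: measurableX.
have -> : leb3 R (J `*` J `*` J) = (leb2 R (J `*` J) * leb1 R J)%E.
  exact: product_measure1E.
have -> : leb2 R (J `*` J) = (leb1 R J * leb1 R J)%E.
  exact: product_measure1E.
by rewrite EJ -!EFinM; congr EFin; ring.
Qed.

(** The ball lies between the centred cubes of half-side [r / 2] and [r]; the smaller one fits
    because 3 (r/2)^2 < r^2. Positivity makes the mean of a constant equal to that constant. *)
Lemma leb3_ball3 (R : realType) (r : R) : 0 < r -> (0 < leb3 R (ball3 r) < +oo)%E.
Proof.
move=> r0.
have mbox (a b : R) : let J : set (measurableTypeR R) := `]a, b[%classic in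
    measurable (J `*` J `*` J).
  by move=> J; apply: measurableX; [apply: measurableX|]; exact: measurable_itv.
apply/andP; split.
- have le1 : - (r / 2) <= r / 2 by lra.
  apply: (@lt_le_trans _ _ ((r / 2 - - (r / 2)) ^+ 3)%:E).
    by rewrite lte_fin exprn_gt0//; lra.
  rewrite -(leb3_box le1); apply: le_measure; rewrite ?inE//.
  - exact: measurable_ball3.
  move=> [[x y] z] /=; rewrite !in_itv /= => -[[/andP[? ?] /andP[? ?]] /andP[? ?]].
  rewrite /ball3 /enorm3 /= -(@ltr_pXn2r _ 2) ?nnegrE ?sqrtr_ge0 ?(ltW r0)//.
  rewrite sqr_sqrtr ?addr_ge0 ?sqr_ge0//; nra.
- have le1 : - r <= r by lra.
  apply: (@le_lt_trans _ _ ((r - - r) ^+ 3)%:E); last exact: ltry.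
  rewrite -(leb3_box le1); apply: le_measure; rewrite ?inE//.
  - exact: measurable_ball3.
  move=> [[x y] z]; rewrite /ball3 /enorm3 /= => h.
  have {h} : x ^+ 2 + y ^+ 2 + z ^+ 2 < r ^+ 2.
    rewrite -[ltLHS]sqr_sqrtr ?addr_ge0 ?sqr_ge0//.
    by rewrite ltr_pXn2r ?nnegrE ?sqrtr_ge0 ?(ltW r0).
  have := (sqr_ge0 x, sqr_ge0 y, sqr_ge0 z) => -[[x2 y2] z2] h.
  have bnd (t : R) : t ^+ 2 < r ^+ 2 -> t \in `]- r, r[.
    move=> tr; rewrite in_itv /= -ltr_norml -(@ltr_pXn2r _ 2) ?nnegrE ?(ltW r0)//.
    by rewrite real_normK ?num_real.
  by split; [split|]; apply: bnd; lra.
Qed.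

Lemma leb4_cyl (R : realType) (r : R) : 0 < r -> (leb4 R (cyl r) < +oo)%E.
Proof.
move=> r0; have /andP[_ B] := leb3_ball3 r0.
have -> : leb4 R (cyl r) = (leb3 R (ball3 r) * leb1 R (time_itv r))%E.
  by apply: product_measure1E; [exact: measurable_ball3|exact: measurable_time_itv].
rewrite lte_mul_pinfty// ?ge0_fin_numE//.
by rewrite /leb1 /time_itv lebesgue_measure_itv /=; case: ifP => _; exact: ltry.
Qed.

Lemma cyl_subset1 (R : realType) (r : R) : 0 <= r -> r <= 1 -> cyl r `<=` cyl 1.
Proof.
move=> r0 r1 [x s]; rewrite /cyl /ball3 /time_itv /= !in_itv /= => -[h /andP[s1 ->]].
split; first exact: lt_le_trans r1.
by rewrite andbT (le_lt_trans _ s1)// lerN2 expr1n expr_le1.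
Qed.

(** * From norms on a set to integrals over it *)

Lemma Lp_on_measurable (R : realType) (p : R) (A B : set (spacetime R))
    (f : spacetime R -> R) :
  measurable A -> B `<=` A -> Lp_on p A f -> measurable_fun B f.
Proof.
move=> mA BA /andP[]; rewrite inE /= => + _.
by move/(measurable_restrictT f mA); exact: measurable_funS.
Qed.

(** On a set of finite measure, |f| <= 1 + |f|^p is integrable; this bound is [mulr_powR_le] at
    [c = 1]. It makes the pressure means meaningful on almost every slice. *)
Lemma Lp_on_integrable (R : realType) (p : R) (A B : set (spacetime R))
    (f : spacetime R -> R) :
  1 <= p -> measurable A -> measurable B -> B `<=` A -> (leb4 R B < +oo)%E ->
  Lp_on p A f -> (leb4 R).-integrable B (EFin \o f).
Proof.
move=> p1 mA mB BA Boo Af.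
have mf := Lp_on_measurable mA BA Af.
have ifp := integrableS measurableT mB (@subsetT _ B) (Lfun_integrable p1 Af).
have i1 := integrable_cst_on 1 mB Boo.
apply: le_integrable (integrableD mB i1 ifp) => //.
  exact/measurable_EFinP.
move=> z Bz /=; rewrite patchE mem_set; last exact: BA.
rewrite lee_fin; apply: le_trans (ler_norm _).
have := mulr_powR_le p1 (ler01 : 0 <= 1 :> R) (normr_ge0 (f z)).
by rewrite !powR1 mul1r.
Qed.

Lemma Lnorm_on_lt (R : realType) (p d : R) (A : set (spacetime R))
    (f : spacetime R -> R) : 0 < p ->
  (Lnorm_on p A f < d%:E)%E ->
  (\int[leb4 R]_(z in A) (`|f z| `^ p)%:E <= (d `^ p)%:E)%E.
Proof.
move=> p0 fd.
have -> : (\int[leb4 R]_(z in A) (`|f z| `^ p)%:E = Lnorm_on p A f `^ p)%E.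
  rewrite /Lnorm_on poweR_Lnorm ?gt_eqF// [LHS]integral_mkcond.
  apply: eq_integral => z _.
  (* Off [A] the extension contributes 0^p, which is 0 because [p] is positive. *)
  by rewrite /= !patchE; case: ifP => //; rewrite normr0 powR0// gt_eqF.
rewrite -poweR_EFin; apply: gt0_ler_poweR; rewrite ?in_itv /= ?leey ?andbT.
- exact: ltW.
- exact: Lnorm_ge0.
- exact: le_trans (Lnorm_ge0 _ _ _) (ltW fd).
- exact: ltW.
Qed.

(** * Comparison of [Phi] for two pairs of fields *)

(** This is [integral_powRD_le] at exponent 3, with [enorm3_le_add] as the pointwise bound. *)
Lemma Phi_velocity_le (R : realType) (r d : R) (w v : admissible_fields R) :
  0 < r -> r <= 1 ->
  (Lnorm_on 3 (cyl r) (fun z => enorm3 (vel w z - vel v z)%R) < d%:E)%E ->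
  (\int[leb4 R]_(z in cyl r) (enorm3 (vel w z) ^+ 3)%:E
     <= 2%:E * \int[leb4 R]_(z in cyl r) (enorm3 (vel v z) ^+ 3)%:E
        + 125%:E * (d `^ 3)%:E)%E.
Proof.
move=> r0 r1 wvd.
have cubeE (u : spacetime R -> R * R * R) :
    (\int[leb4 R]_(z in cyl r) (enorm3 (u z) ^+ 3)%:E
       = \int[leb4 R]_(z in cyl r) (`|enorm3 (u z)| `^ 3)%:E)%E.
  apply: eq_integral => z _.
  by rewrite ger0_norm ?enorm3_ge0// powR_mulrn ?enorm3_ge0.
have sub1 := cyl_subset1 (ltW r0) r1.
have mvel (u : admissible_fields R) :
    [/\ measurable_fun (cyl r) (fun z => (vel u z).1.1),
        measurable_fun (cyl r) (fun z => (vel u z).1.2) &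
        measurable_fun (cyl r) (fun z => (vel u z).2)].
  by have [u1 u2 u3] := vel_L3 u; split;
    apply: (Lp_on_measurable (measurable_cyl 1) sub1); eassumption.
have [[w1 w2 w3] [v1 v2 v3]] := (mvel w, mvel v).
rewrite !cubeE.
apply: (le_trans (@integral_powRD_le _ _ _ (leb4 R) _ 3 _
  (fun z => enorm3 (vel v z)) (fun z => enorm3 (vel w z - vel v z))
  _ _ (measurable_cyl r) _ _ _ _)) => //.
- exact: measurable_enorm3.
- exact: measurable_enorm3.
- by apply: measurable_enorm3; exact: measurable_funB.
- by move=> z _; rewrite !ger0_norm ?enorm3_ge0// enorm3_le_add.
by rewrite leeD2l// lee_pmul2l ?lte_fin// Lnorm_on_lt.
Qed.

(** A strict bound on the infimum provides one measurable gauge [a] whose norm is still below [d];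
    [integral_oscillation_perturb] at exponent 3/2 then applies to it. *)
Lemma Phi_pressure_le (R : realType) (r d : R) (w v : admissible_fields R) :
  0 < r -> r <= 1 ->
  (pressure_dist r (pres w) (pres v) < d%:E)%E ->
  (\int[leb1 R]_(s in time_itv r) \int[leb3 R]_(y in ball3 r)
       (`|pres w (y, s) - ball_mean r (pres w) s| `^ (3 / 2))%:E
     <= 2%:E * \int[leb1 R]_(s in time_itv r) \int[leb3 R]_(y in ball3 r)
       (`|pres v (y, s) - ball_mean r (pres v) s| `^ (3 / 2))%:E
     + (125 * 1002)%:E * (d `^ (3 / 2))%:E)%E.
Proof.
move=> r0 r1 /ereal_inf_lt[_ [a ma <-]] ad.
have p1 : 1 <= 3 / 2 :> R by lra.
have p3 : 3 / 2 <= 3 :> R by lra.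
have ip (u : admissible_fields R) : (leb4 R).-integrable (cyl r) (EFin \o pres u).
  apply: (Lp_on_integrable p1 (measurable_cyl 1) (measurable_cyl r)).
  - exact: cyl_subset1 (ltW r0) r1.
  - exact: leb4_cyl.
  - exact: pres_L32.
apply: (le_trans (integral_oscillation_perturb (measurable_ball3 r)
  (measurable_time_itv r) (leb3_ball3 r0) p1 p3 (ip w) (ip v) ma)).
apply: leeD2l; apply: lee_wpmul2l.
  by rewrite lee_fin; exact: mulr_ge0 (ler0n _ _) (ler0n _ _).
by apply: Lnorm_on_lt => //; lra.
Qed.

Lemma Phi_le_of_dist (R : realType) (r d : R) (w v : admissible_fields R) :
  0 < r -> r <= 1 -> 0 <= d -> d <= 1 -> (fields_dist r w v < d%:E)%E ->
  (Phi r w <= 2%:E * Phi r v + ((125 + 125 * 1002) * d)%:E)%E.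
Proof.
move=> r0 r1 d0 d1 wvd.
have N0 : (0 <= Lnorm_on 3 (cyl r) (fun z => enorm3 (vel w z - vel v z)%R))%E.
  exact: Lnorm_ge0.
(* Both summands of [fields_dist] are nonnegative, so each one separately is below [d]. *)
have P0 : (0 <= pressure_dist r (pres w) (pres v))%E.
  by apply: le_ereal_inf_tmp => _ [a _ <-]; exact: Lnorm_ge0.
have Nd := Phi_velocity_le r0 r1 (le_lt_trans (leeDl _ P0) wvd).
have Pd := Phi_pressure_le r0 r1 (le_lt_trans (leeDr _ N0) wvd).
apply: (le_trans (leeD Nd Pd)).
(* Since [d <= 1], the errors d^3 and d^(3/2) are both at most [d], which makes the total error
   linear in [d]. *)
have dp (p : R) : 1 <= p -> d `^ p <= d.
  move=> p1; move: d0; rewrite le_eqVlt => /predU1P[<-|dgt0].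
    by rewrite powR0// gt_eqF// (lt_le_trans _ p1).
  rewrite -[X in _ <= X](powRr1 (ltW dgt0)).
  by apply: ger_powR => //; rewrite dgt0.
rewrite /Phi; set U := (X in (_ <= _ * (X + _) + _)%E).
set V := (X in (_ <= _ * (_ + X) + _)%E).
have U0 : (0 <= U)%E.
  by apply: integral_ge0 => z _; rewrite lee_fin exprn_ge0 ?enorm3_ge0.
have V0 : (0 <= V)%E.
  apply: integral_ge0 => s _; apply: integral_ge0 => y _.
  by rewrite lee_fin powR_ge0.
rewrite (ge0_muleDr _ U0 V0) addeACA; apply: leeD2l.
rewrite -!EFinM -EFinD lee_fin (mulrDl 125 _ d).
apply: lerD.
  by apply: ler_wpM2l; [exact: ler0n|apply: dp; rewrite ler1n].
apply: ler_wpM2l; first exact: mulr_ge0 (ler0n _ _) (ler0n _ _).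
by apply: dp; lra.
Qed.

(** * Choice of the smallness threshold *)

Theorem theorem16p12 (R : realType) (theta epsCKN : R)
  (theta0 : 0 < theta) (theta1 : theta < 1) (epsCKN0 : 0 < epsCKN) :
  exists2 tauCKN : R, 0 < tauCKN &
  forall (Pkg : Type) (fields : Pkg -> admissible_fields R)
    (Par : Type) (Gamma : Par -> nat -> set Pkg) (Lambda : Par) (k : nat)
    (Dk : Pkg) (deltak Deltagauge CCKNaud : R),
  ckn_clean_class fields theta epsCKN (Gamma Lambda k) ->
  0 <= deltak -> 0 <= Deltagauge -> 0 <= CCKNaud ->
  (ckn_dist fields theta Dk (Gamma Lambda k)
     <= (CCKNaud * deltak + Deltagauge)%:E)%E ->
  CCKNaud * deltak + Deltagauge <= tauCKN ->
  (Phi theta (fields Dk) < epsCKN%:E)%E.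
Proof.
have [C C0 CE] : exists2 C : R, 0 < C & C = 125 + 125 * 1002.
  refine (ex_intro2 _ _ (125 + 125 * 1002) _ erefl).
  by apply: addr_gt0; [|apply: mulr_gt0]; rewrite ltr0n.
(* The entry 1 meets the condition [d <= 1] of [Phi_le_of_dist]; the other entry keeps the error
   [C * d] within [epsCKN / 4]. *)
pose d := Num.min 1 (epsCKN / (4 * C)).
have d0 : 0 < d by rewrite lt_min ltr01 divr_gt0// mulr_gt0.
have d1 : d <= 1 by rewrite ge_min lexx.
have Cd : C * d <= epsCKN / 4.
  rewrite -ler_pdivlMl//; apply: (@le_trans _ _ (epsCKN / (4 * C))).
    by rewrite ge_min lexx orbT.
  by rewrite invfM mulrA mulrC.
(* The smallness hypothesis is not strict; halving [d] makes the distance strictly less than [d], so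
   an actual clean [zeta] realises the bound. In particular the class is then nonempty, as its
   distance would otherwise be infinite. *)
exists (d / 2); first by rewrite divr_gt0.
move=> Pkg fields Par Gamma Lambda k Dk delta Delta A clean _ _ _ dist small.
have /ereal_inf_lt[_ [zeta Gzeta <-] zetad] :
    (ckn_dist fields theta Dk (Gamma Lambda k) < d%:E)%E.
  by rewrite (le_lt_trans dist)// lte_fin (le_lt_trans small)//; lra.
apply: (le_lt_trans (Phi_le_of_dist theta0 (ltW theta1) (ltW d0) d1 zetad)).
rewrite -CE.
(* The total is at most [epsCKN / 2 + epsCKN / 4], strictly below [epsCKN]. *)
apply: (@le_lt_trans _ _ (2 * (epsCKN / 4) + C * d)%:E).
  rewrite (EFinD (2 * _)) (EFinM 2); apply: leeD2r.
  by rewrite lee_pmul2l ?lte_fin//; exact: clean.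
by rewrite lte_fin; lra.
Qed.
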